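(* Let $f\in L^2(-\pi,\pi)$ (extended $2\pi$-periodically) and let $K_1<K_2$ be integers. Let $$\hat f_k=\frac{1}{2\pi}\int_{-\pi}^{\pi}f(x)e^{-ikx}\,dx,\qquad S_{K_1,K_2}f(x)=\sum_{k=K_1}^{K_2}\hat f_k\,e^{ikx}.$$ Define the central frequency $K_c=(K_1+K_2)/2$ and the bandwidth $B=K_2-K_1$. Then $$S_{K_1,K_2}f(x)=\bigl(f*G(\cdot\,;K_c,B)\bigr)(x),\qquad\text{where } G(x;K_c,B)=e^{iK_cx}D_{B/2}(x).$$
   Context: For a nonnegative integer or half-integer $n$, the Dirichlet kernel is $D_n(x)=\sum_{k\in\{-n,-n+1,\dots,n\}}e^{ikx}=\frac{\sin((n+1/2)x)}{\sin(x/2)}$ (extended by continuity at $x\in2\pi\mathbb{Z}$). The convolution is $(f*g)(x)=\frac{1}{2\pi}\int_{-\pi}^{\pi}f(y)g(x-y)\,dy$. *)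

(* Defs.v *)
From mathcomp Require Export all_boot all_order all_algebra.
From mathcomp Require Export all_classical all_reals all_analysis.
From mathcomp Require Export complex.
From mathcomp Require Import ring.
Set Implicit Arguments.
Unset Strict Implicit.
Unset Printing Implicit Defensive.
Import Order.TTheory GRing.Theory Num.Theory.
Local Open Scope ring_scope.
Local Open Scope classical_set_scope.
Local Open Scope complex_scope.

Definition expi (R : realType) (t : R) : R[i] := cos t +i* sin t.

(* The library integrates real-valued functions only; a complex-valued
   function is integrated through its real and imaginary parts. *)
Definition Cintegral (R : realType) (D : set R) (f : R -> R[i]) : R[i] :=
  (\int[lebesgue_measure]_(x in D) complex.Re (f x)) +i*
  (\int[lebesgue_measure]_(x in D) complex.Im (f x)).

(* Everywhere-defined representatives of the classes in L^2(D; C). *)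
Definition square_integrable (R : realType) (D : set R) (f : R -> R[i]) : Prop :=
  [/\ measurable_fun D (fun x => complex.Re (f x)),
      measurable_fun D (fun x => complex.Im (f x)) &
      (\int[lebesgue_measure]_(x in D) ((Normc.normc (f x)) ^+ 2)%:E < +oo)%E].

Definition mean_2pi (R : realType) (f : R -> R[i]) : R[i] :=
  ((2 * pi)^-1)%:C * Cintegral `]- pi, pi[ f.

Definition fourier_coef (R : realType) (f : R -> R[i]) (k : int) : R[i] :=
  mean_2pi (fun x => f x * expi (- (k%:~R * x))).

Definition fourier_sum (R : realType) (K1 K2 : int) (f : R -> R[i]) (x : R) :
    R[i] :=
  \sum_(k \in `[K1, K2]) fourier_coef f k * expi (k%:~R * x).

Definition convolution (R : realType) (f g : R -> R[i]) (x : R) : R[i] :=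
  mean_2pi (fun y => f y * g (x - y)).

(* D_n for n a nonnegative integer or half-integer: the index set
   {-n, -n + 1, ..., n} has 2n + 1 elements, the j-th one being -n + j.
   The value is not meaningful when 2n is not a natural number. *)
Definition dirichlet (R : realType) (n x : R) : R[i] :=
  \sum_(0 <= j < (Num.truncn (2 * n)).+1) expi ((- n + j%:R) * x).

Definition bandpass_kernel (R : realType) (Kc B : R) (x : R) : R[i] :=
  expi (Kc * x) * dirichlet (B / 2) x.

Lemma dirichlet_half (R : realType) (m : nat) (x : R) :
  dirichlet (m%:R / 2) x = \sum_(0 <= j < m.+1) expi ((- (m%:R / 2) + j%:R) * x).
Proof.
rewrite /dirichlet.
have -> : 2 * (m%:R / 2) = m%:R :> R by field.
by rewrite natrK.
Qed.

Lemma dirichletE (R : realType) (m : nat) (x : R) : sin (x / 2) != 0 ->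
  dirichlet (m%:R / 2) x = (sin ((m%:R / 2 + 1 / 2) * x) / sin (x / 2))%:C.
Proof.
move=> s0; rewrite dirichlet_half.
suff H : forall p : nat,
  \sum_(0 <= j < p) expi ((- (m%:R / 2) + j%:R) * x) =
  ((sin ((- (m%:R / 2) + p%:R - 1 / 2) * x) +
    sin ((m%:R / 2 + 1 / 2) * x)) / (2 * sin (x / 2))) +i*
  ((cos ((m%:R / 2 + 1 / 2) * x) -
    cos ((- (m%:R / 2) + p%:R - 1 / 2) * x)) / (2 * sin (x / 2))).
  rewrite H.
  have -> : (- (m%:R / 2) + m.+1%:R - 1 / 2) = m%:R / 2 + 1 / 2 :> R.
    by rewrite -natr1; field.
  by rewrite subrr mul0r; congr (_ +i* _); field.
elim=> [|p IH].
  rewrite big_nil.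
  have -> : (- (m%:R / 2) + 0%:R - 1 / 2) * x = - ((m%:R / 2 + 1 / 2) * x).
    by field.
  by rewrite sinN cosN addNr subrr !mul0r.
rewrite big_nat_recr//= IH.
set a := (- (m%:R / 2) + p%:R) * x.
have -> : (- (m%:R / 2) + p%:R - 1 / 2) * x = a - x / 2 by rewrite /a; field.
have -> : (- (m%:R / 2) + p.+1%:R - 1 / 2) * x = a + x / 2.
  by rewrite /a -natr1; field.
rewrite sinB cosB sinD cosD /expi.
by congr (_ +i* _) => /=; field.
Qed.

(* Main.v *)
Require Import Defs.
From mathcomp Require Import measurable_realfun ring lra zify.
Import Order.TTheory GRing.Theory Num.Theory.
Local Open Scope ring_scope.
Local Open Scope classical_set_scope.
Local Open Scope complex_scope.

(** Modulating by the central frequency translates the spectrum of the Dirichlet kernel: the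
    frequencies $-B/2,\dots,B/2$ become $K_1,\dots,K_2$, so $G(x)=\sum_{k=K_1}^{K_2}e^{ikx}$
    ([bandpass_kernelE]). Each $e^{ik(x-y)}$ splits as $e^{-iky}e^{ikx}$, and linearity of the
    integral in $y$ ([Cintegral_sum], [CintegralZr]) turns the convolution into $\sum_k\hat f_k
    e^{ikx}$. The analytic input is integrability of $f(y)e^{-iky}$: multiplication by a character
    preserves $L^2$ ([square_integrable_expi]), and $L^2\subset L^1$ on a set of finite measure
    ([square_integrable_Cintegrable]). *)

Lemma expiD (R : realType) (s t : R) : expi (s + t) = expi s * expi t.
Proof. by rewrite /expi cosD sinD; simpc; congr (_ +i* _); rewrite addrC. Qed.

Lemma normc_expi (R : realType) (t : R) : Normc.normc (expi t) = 1.
Proof. by rewrite /expi/= cos2Dsin2 sqrtr1. Qed.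

Lemma sqr_normc (R : realType) (z : R[i]) :
  Normc.normc z ^+ 2 = complex.Re z ^+ 2 + complex.Im z ^+ 2.
Proof. by case: z => a b /=; rewrite sqr_sqrtr// addr_ge0 ?sqr_ge0. Qed.

Definition Cintegrable {R : realType} (D : set R) (g : R -> R[i]) :=
  lebesgue_measure.-integrable D (EFin \o (fun x => complex.Re (g x))) /\
  lebesgue_measure.-integrable D (EFin \o (fun x => complex.Im (g x))).

Section Cintegral.
(* [lebesgue_measure] is a measure on [measurableTypeR R], which has the Borel
   sets of [R] under another display; typing [D] there lets lemmas unify. *)
Variables (R : realType) (D : set (measurableTypeR R)) (mD : measurable D).

Lemma CintegrableD (g h : R -> R[i]) : Cintegrable D g -> Cintegrable D h ->
  Cintegrable D (fun x => g x + h x).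
Proof.
move=> [gr gi] [hr hi]; split.
- apply: (eq_integrable mD _ _ _ (integrableD mD gr hr)) => x _ /=.
  by rewrite raddfD EFinD.
- apply: (eq_integrable mD _ _ _ (integrableD mD gi hi)) => x _ /=.
  by rewrite raddfD EFinD.
Qed.

Lemma CintegralD (g h : R -> R[i]) : Cintegrable D g -> Cintegrable D h ->
  Cintegral D (fun x => g x + h x) = Cintegral D g + Cintegral D h.
Proof.
move=> [gr gi] [hr hi]; rewrite /Cintegral; simpc.
congr (_ +i* _); rewrite -RintegralD//;
  by apply: eq_Rintegral => x _; rewrite raddfD.
Qed.

Lemma Cintegrable0 : Cintegrable D (fun=> 0).
Proof. by split; apply: integrable0. Qed.

Lemma Cintegral0 : Cintegral D (fun=> 0) = 0.
Proof. by rewrite /Cintegral/= /Rintegral integral0. Qed.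

Lemma Cintegrable_sum (I : Type) (s : seq I) (g : I -> R -> R[i]) :
  (forall i, Cintegrable D (g i)) -> Cintegrable D (fun x => \sum_(i <- s) g i x).
Proof.
move=> gD; elim: s => [|i s IH].
  by under eq_fun do rewrite big_nil; exact: Cintegrable0.
by under eq_fun do rewrite big_cons; exact: CintegrableD.
Qed.

Lemma Cintegral_sum (I : Type) (s : seq I) (g : I -> R -> R[i]) :
  (forall i, Cintegrable D (g i)) ->
  Cintegral D (fun x => \sum_(i <- s) g i x) = \sum_(i <- s) Cintegral D (g i).
Proof.
move=> gD; elim: s => [|i s IH].
  by under eq_fun do rewrite big_nil; rewrite Cintegral0 big_nil.
under eq_fun do rewrite big_cons.
by rewrite big_cons CintegralD ?IH//; exact: Cintegrable_sum.
Qed.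

(** A complex factor $a+ib$ mixes the two components of $u+iv$ into $au-bv$ and $bu+av$, which are
    real linear combinations of integrable functions. *)
Lemma CintegrableZr (g : R -> R[i]) (c : R[i]) : Cintegrable D g ->
  Cintegrable D (fun x => g x * c).
Proof.
case: c => a b [gr gi]; split.
- apply: (eq_integrable mD _ _ _ (integrableD mD (integrableZl mD a gr)
    (integrableZl mD (- b) gi))) => x _ /=.
  by case: (g x) => u v /=; congr EFin; ring.
- apply: (eq_integrable mD _ _ _ (integrableD mD (integrableZl mD b gr)
    (integrableZl mD a gi))) => x _ /=.
  by case: (g x) => u v /=; congr EFin; ring.
Qed.

Lemma CintegralZr (g : R -> R[i]) (c : R[i]) : Cintegrable D g ->
  Cintegral D (fun x => g x * c) = Cintegral D g * c.
Proof.
case: c => a b [gr gi]; rewrite /Cintegral; simpc.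
have zl r h : lebesgue_measure.-integrable D (EFin \o h) ->
    lebesgue_measure.-integrable D (EFin \o (fun x => r * h x)).
  by move=> hD; exact: (integrableZl mD r hD).
congr (_ +i* _).
- transitivity (\int[lebesgue_measure]_(x in D)
    (a * complex.Re (g x) + - b * complex.Im (g x))).
    by apply: eq_Rintegral => x _; case: (g x) => u v /=; ring.
  by rewrite RintegralD ?RintegralZl//; [ring|exact: zl|exact: zl].
- transitivity (\int[lebesgue_measure]_(x in D)
    (b * complex.Re (g x) + a * complex.Im (g x))).
    by apply: eq_Rintegral => x _; case: (g x) => u v /=; ring.
  by rewrite RintegralD ?RintegralZl//; [ring|exact: zl|exact: zl].
Qed.

(** Both components are dominated by $1+|g|^2$, where the constant $1$ is integrable because [D] has
    finite measure. *)
Lemma square_integrable_Cintegrable (g : R -> R[i]) :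
  (lebesgue_measure D < +oo)%E -> square_integrable D g -> Cintegrable D g.
Proof.
move=> Dfin [mr mi goo].
have sqr_int : lebesgue_measure.-integrable D
    (EFin \o (fun x => Normc.normc (g x) ^+ 2)).
  apply/integrableP; split.
    apply/measurable_EFinP; under eq_fun do rewrite sqr_normc.
    by apply: measurable_funD; apply: measurable_funX.
  by under eq_integral do rewrite /= ger0_norm ?sqr_ge0//.
have cst_int : lebesgue_measure.-integrable D (cst 1%E).
  apply/integrableP; split; first exact: measurable_cst.
  under eq_integral do rewrite abse1.
  by rewrite integral_cst// mul1e.
have h_int : lebesgue_measure.-integrable D
    (EFin \o (fun x => 1 + Normc.normc (g x) ^+ 2)).
  exact: integrableD cst_int sqr_int.
have dom (u v : R) : `|u| <= 1 + (u ^+ 2 + v ^+ 2).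
  (* Expanding this square gives $2|u|\le 1+u^2$. *)
  have : 0 <= (`|u| - 1) ^+ 2 by rewrite sqr_ge0.
  rewrite -(real_normK (num_real u)); have := sqr_ge0 v; nra.
split; apply: (le_integrable mD _ _ h_int);
  rewrite ?measurable_EFinP// => x _ /=;
  rewrite lee_fin sqr_normc (ger0_norm (addr_ge0 _ (addr_ge0 _ _))) ?sqr_ge0//.
by rewrite (addrC (_ ^+ 2)) dom.
Qed.

(** Since $|e^{icx}|=1$, the integral of the squared modulus is unchanged; measurability follows
    from the continuity of [cos] and [sin]. *)
Lemma square_integrable_expi (g : R -> R[i]) (c : R) :
  square_integrable D g -> square_integrable D (fun x => g x * expi (c * x)).
Proof.
move=> [mr mi goo].
have mcos : measurable_fun D (fun x => cos (c * x)).
  apply: measurable_funTS; apply: measurableT_comp => //.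
  by apply: continuous_measurable_fun; exact: continuous_cos.
have msin : measurable_fun D (fun x => sin (c * x)).
  apply: measurable_funTS; apply: measurableT_comp => //.
  by apply: continuous_measurable_fun; exact: continuous_sin.
split.
- have -> : (fun x => complex.Re (g x * expi (c * x))) =
     (fun x => complex.Re (g x) * cos (c * x) - complex.Im (g x) * sin (c * x)).
    by apply/funext => x; case: (g x).
  by apply: measurable_funB; apply: measurable_funM.
- have -> : (fun x => complex.Im (g x * expi (c * x))) =
     (fun x => complex.Re (g x) * sin (c * x) + complex.Im (g x) * cos (c * x)).
    by apply/funext => x; case: (g x).
  by apply: measurable_funD; apply: measurable_funM.
- by under eq_integral do rewrite Normc.normcM normc_expi mulr1.
Qed.

End Cintegral.

(** Indexing by the offset $j=k-K$ gives the Fourier sum the same index range as the sum in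
    [dirichlet_half]. *)
Lemma fsbig_itv_int (V : nmodType) (F : int -> V) (K : int) (m : nat) :
  \sum_(k \in `[K, K + m%:Z]) F k = \sum_(0 <= j < m.+1) F (K + j%:Z).
Proof.
rewrite big_mkord (fsbig_ord _ m.+1 (fun j => F (K + j%:Z))).
apply: (@reindex_fsbig _ _ _ _ _ (fun j : nat => K + j%:Z)); split.
- by move=> j /=; rewrite in_itv/= ltnS => jm; apply/andP; split; lia.
- by move=> i j _ _ /addrI [].
- move=> k /=; rewrite in_itv/= => /andP[Kk kK].
  by exists `|k - K|%N => /=; lia.
Qed.

(** The central frequency is $K+m/2$, so adding it to $-m/2+j$ cancels the half-integers and leaves
    the integer $K+j$. *)
Lemma bandpass_kernelE (R : realType) (K : int) (m : nat) (x : R) :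
  bandpass_kernel ((K%:~R + (K + m%:Z)%:~R) / 2) m%:R x =
  \sum_(0 <= j < m.+1) expi ((K + j%:Z)%:~R * x).
Proof.
rewrite /bandpass_kernel dirichlet_half big_distrr/=.
apply: eq_bigr => j _; rewrite -expiD; congr expi.
by rewrite !intrD !pmulrn; field.
Qed.

Theorem proposition1 (R : realType) (f : R -> R[i]) (K1 K2 : int)
    (f_L2 : square_integrable `]- pi, pi[ f)
    (f_periodic : periodic f (2 * pi))
    (ltK : K1 < K2) :
  let Kc : R := (K1%:~R + K2%:~R) / 2 in
  let B : R := K2%:~R - K1%:~R in
  forall x : R,
    fourier_sum K1 K2 f x = convolution f (bandpass_kernel Kc B) x.
Proof.
move=> Kc B x; rewrite /Kc /B {Kc B}.
(* With the bandwidth a natural number [m], the truncation in [dirichlet] is exact and the kernel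
   has [m.+1] terms. *)
have [m ->] : exists m : nat, K2 = K1 + m%:Z.
  by exists `|K2 - K1|%N; lia.
have -> : (K1 + m%:Z)%:~R - K1%:~R = m%:R :> R by rewrite intrD pmulrn; ring.
rewrite /fourier_sum fsbig_itv_int /convolution.
pose D : set (measurableTypeR R) := `]- pi, pi[.
have mD : measurable D by exact: measurable_itv.
have Dfin : (lebesgue_measure D < +oo)%E.
  by rewrite lebesgue_measure_itv/=; case: ifP => // _; rewrite -EFinB ltry.
(* These are the integrands of the Fourier coefficients; their integrability justifies both
   exchanging sum and integral and extracting constants. *)
have intf k : Cintegrable D (fun y => f y * expi (- (k%:~R * y))).
  apply: square_integrable_Cintegrable => //.
  by under eq_fun do rewrite -mulNr; exact: square_integrable_expi.
(* The variables separate: for each frequency, the factor in $x$ is constant for the integration in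
   $y$. *)
have -> : (fun y => f y *
    bandpass_kernel ((K1%:~R + (K1 + m%:Z)%:~R) / 2) m%:R (x - y)) =
  (fun y => \sum_(0 <= j < m.+1)
    f y * expi (- ((K1 + j%:Z)%:~R * y)) * expi ((K1 + j%:Z)%:~R * x)).
  apply/funext => y; rewrite bandpass_kernelE big_distrr/=.
  apply: eq_bigr => j _; rewrite -mulrA -expiD.
  by congr (_ * expi _); ring.
rewrite /mean_2pi -/D Cintegral_sum//; last first.
  by move=> j; exact: CintegrableZr.
rewrite big_distrr/=; apply: eq_bigr => j _.
(* Pulling out $e^{ikx}$ leaves exactly the mean defining $\hat f_k$. *)
by rewrite CintegralZr// mulrA.
Qed.
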